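(* Let $X$ be a centered infinitely divisible random vector in $\mathbb{R}^d$ with finite second moment and covariance matrix $\Sigma$. Assume that $\Sigma$ is positive definite and that $K_X(t)<\infty$ for every $t\in\mathbb{R}^d$. Then $u\mapsto C_X(u)$ is finite and continuous on the unit sphere $\mathbb{S}^{d-1}$.
   Context: $K_X(t):=\log\mathbb{E}e^{\langle t,X\rangle}$ (value $+\infty$ allowed) and $V_X(t):=t^\top\Sigma t$. Directional (radial) pole: if $V_X(t)>0$, $C_X(t)\in[0,\infty]$ is the infimum of all $c\in[0,\infty)$ such that $$K_X(st)\le\frac{V_X(t)s^2}{2(1-cs)}\qquad\text{for all }0\le s<1/c,$$ with $1/0=\infty$ and $\inf\emptyset=\infty$. If $V_X(t)=0$, $C_X(t):=0$. *)

(* Defs.v *)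
From HB Require Import structures.
From mathcomp Require Import all_boot all_order all_algebra.
From mathcomp Require Import all_classical all_reals all_analysis.
Set Implicit Arguments.
Unset Strict Implicit.
Unset Printing Implicit Defensive.
Import Order.TTheory GRing.Theory Num.Theory.
Import numFieldNormedType.Exports.
Local Open Scope classical_set_scope.
Local Open Scope ring_scope.

(* A random vector in R^n is a measurable map X into [n.-tuple R], whose
   sigma-algebra in the library is the one generated by the coordinates, i.e.
   the Borel one. Deterministic vectors are columns ['cV[R]_n]; their library
   topology, generated by the sup norm, is the usual one. *)

Section euclidean.
Context {R : realType} {n : nat}.

Definition vec (x : n.-tuple R) : 'cV[R]_n := \col_i tnth x i.

Definition dotp (u v : 'cV[R]_n) : R := \sum_(i < n) u i 0 * v i 0.

Definition enorm (u : 'cV[R]_n) : R := Num.sqrt (dotp u u).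

Definition unit_sphere : set 'cV[R]_n := [set u | enorm u = 1].

Definition quad_form (M : 'M[R]_n) (t : 'cV[R]_n) : R := (t^T *m M *m t) 0 0.

Definition posdefmx (M : 'M[R]_n) : Prop :=
  M^T = M /\ forall t : 'cV[R]_n, t != 0 -> 0 < quad_form M t.

Definition sum_tuple m (y : 'I_m -> n.-tuple R) : n.-tuple R :=
  [tuple \sum_(k < m) tnth (y k) i | i < n].

End euclidean.

Section random_vectors.
Context {R : realType} {n : nat} {d : measure_display} {T : measurableType d}.
Variable P : probability T R.
Implicit Type X : {RV P >-> n.-tuple R}.

(* Since the sets A k may be the whole space, this product rule for the full
   finite family contains the ones for all its subfamilies. *)
Definition mutually_independent m (Y : 'I_m -> {RV P >-> n.-tuple R}) : Prop :=
  forall A : 'I_m -> set (n.-tuple R), (forall k, measurable (A k)) ->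
    P (\bigcap_k (Y k @^-1` A k)) = (\prod_(k < m) P (Y k @^-1` A k))%E.

Definition identically_distributed m (Y : 'I_m -> {RV P >-> n.-tuple R}) :
    Prop :=
  forall (k l : 'I_m) (A : set (n.-tuple R)), measurable A ->
    distribution P (Y k) A = distribution P (Y l) A.

Definition centered X : Prop :=
  forall i : 'I_n, 'E_P[fun w => tnth (X w) i]%E = 0%E.

Definition finite_second_moment X : Prop :=
  ('E_P[fun w => (enorm (vec (X w)) ^+ 2)%R] < +oo)%E.

(* [fine] is harmless when the second moment is finite. *)
Definition covmx X : 'M[R]_n :=
  \matrix_(i, j)
    fine (covariance P (fun w => tnth (X w) i) (fun w => tnth (X w) j)).

Definition cumulant X (t : 'cV[R]_n) : \bar R :=
  lne ('E_P[fun w => expR (dotp t (vec (X w)))])%E.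

Definition qvar X (t : 'cV[R]_n) : R := quad_form (covmx X) t.

(* In extended reals [0^-1 = +oo], and [ereal_inf set0 = +oo]. *)
Definition radial_pole X (t : 'cV[R]_n) : \bar R :=
  if 0 < qvar X t then
    ereal_inf [set c%:E | c in [set c : R | 0 <= c /\
      forall s : R, 0 <= s -> (s%:E < c%:E^-1)%E ->
        (cumulant X (s *: t) <=
           (qvar X t * s ^+ 2 / (2 * (1 - c * s)))%:E)%E]]
  else 0%E.

End random_vectors.

(* For every m >= 1, X has the law of a sum of m i.i.d. random vectors, which
   may live on another probability space. *)
Definition infinitely_divisible (R : realType) (n : nat) (d : measure_display)
    (T : measurableType d) (P : probability T R)
    (X : {RV P >-> n.-tuple R}) : Prop :=
  forall m : nat, (0 < m)%N ->
    exists (d' : measure_display) (T' : measurableType d')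
      (P' : probability T' R) (Y : 'I_m -> {RV P' >-> n.-tuple R}),
      [/\ mutually_independent Y, identically_distributed Y &
        forall A : set (n.-tuple R), measurable A ->
          distribution P X A =
          pushforward P' (fun w => sum_tuple (fun k => Y k w)) A].

(* Main.v *)
(* Let [K] be the cumulant generating function and [V] the variance form. Since
   [K >= 0], clearing denominators shows that [c >= 0] is admissible for the
   direction [u] iff [K (s u) - s^2 V u / 2 <= c s K (s u)] for all [s > 0]; for
   [s >= 1/e] this holds as soon as [c >= e]. For [s <= 1/e] divide by [s^3]:
   third-order Taylor remainders, dominated by exponentials of the l1 norm of X,
   show that [(K (s u) - s^2 V u / 2) / s^3] and [K (s u) / s^2] are Lipschitz in
   [u] uniformly in [s], and the latter is bounded below near a given direction.
   Hence an admissible [c] for one direction gives the admissible [c + e] for all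
   nearby directions. *)
Require Import Defs.
From HB Require Import structures.
From mathcomp Require Import all_boot all_order all_algebra.
From mathcomp Require Import all_classical all_reals all_analysis.
From mathcomp Require Import measurable_realfun ring lra.
Set Implicit Arguments.
Unset Strict Implicit.
Unset Printing Implicit Defensive.
Import Order.TTheory GRing.Theory Num.Theory.
Import numFieldNormedType.Exports.
Local Open Scope classical_set_scope.
Local Open Scope ring_scope.

(** * Elementary inequalities for the exponential and the logarithm *)

Section real_inequalities.
Context {R : realType}.
Implicit Types (x y z w a b s k S : R).

(** The tangent inequality [1 + x <= expR x] at [x = p - q], multiplied by [expR q], gives one
    bound; exchanging the two points gives the other. *)
Lemma expRB_bounds y z :
  (y - z) * expR z <= expR y - expR z <= (y - z) * expR y.
Proof.
have h (p q : R) : (p - q) * expR q <= expR p - expR q.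
  have -> : expR p = expR (p - q) * expR q by rewrite -expRD subrK.
  have := expR_ge1Dx (p - q); have := expR_gt0 q; nra.
by have := h y z; have := h z y; lra.
Qed.

Lemma norm_expRB1 y w : `|y| <= w -> `|expR y - 1| <= w * expR w.
Proof.
rewrite ler_norml => /andP[yw wy].
have := expRB_bounds y 0; rewrite expR0 subr0 mulr1 => /andP[y1 y2].
have wexp : expR y <= expR w by rewrite ler_expR.
have w1 : 1 <= expR w by rewrite -expR0 ler_expR; lra.
have := expR_gt0 y.
by rewrite ler_norml => *; apply/andP; split; nra.
Qed.

(** A Lipschitz estimate: the derivative [expR t - 1] of the remainder is at most [w * expR w] in
    absolute value for [t] in [[-w, w]]. *)
Lemma norm_expRBB y z w : `|y| <= w -> `|z| <= w ->
  `|(expR y - 1 - y) - (expR z - 1 - z)| <= `|y - z| * (w * expR w).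
Proof.
wlog zy : y z / z <= y => [hw yw zw|yw zw].
  have [/hw|/ltW/hw] := leP z y; first exact.
  by rewrite distrC [`|z - y|]distrC; exact.
have := expRB_bounds y z => /andP[h1 h2].
rewrite (ger0_norm (_ : 0 <= y - z)); last by rewrite subr_ge0.
have := norm_expRB1 yw; have := norm_expRB1 zw.
rewrite !ler_norml => /andP[? ?] /andP[? ?].
by apply/andP; split; nra.
Qed.

Lemma norm_expR2 y w : `|y| <= w -> `|expR y - 1 - y| <= w ^+ 2 * expR w.
Proof.
move=> yw; have w0 : 0 <= w by exact: le_trans yw.
have := @norm_expRBB y 0 w yw; rewrite normr0 expR0 !subr0 => /(_ w0).
rewrite [1 - 1]subrr subr0 => /le_trans; apply.
rewrite expr2 -mulrA ler_wpM2r // mulr_ge0 // expR_ge0 //.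
Qed.

(* The derivative of [expR t - t ^+ 2 / 2 - t] is [expR t - 1 - t], which
   [norm_expR2] bounds on the segment between the two points. *)
Lemma norm_expRBBB y z w : `|y| <= w -> `|z| <= w ->
  `|(expR y - 1 - y - y ^+ 2 / 2) - (expR z - 1 - z - z ^+ 2 / 2)| <=
  `|y - z| * (w ^+ 2 * expR w).
Proof.
wlog : y z / z <= y => [hw yw zw|].
  have [/hw|/ltW/hw] := leP z y; first exact.
  by rewrite distrC [`|z - y|]distrC; exact.
rewrite le_eqVlt => /predU1P[-> _ _|zy yw zw]; first by rewrite !subrr normr0 mul0r.
pose f (t : R) := expR t - 1 - t - t ^+ 2 / 2.
have df (t : R) : is_derive t 1 f (expR t - 1 - t).
  rewrite /f; apply: is_derive_eq.
  by rewrite /GRing.scale /=; field.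
have cf : {within `[z, y], continuous f}.
  apply: derivable_within_continuous => t _; exact: ex_derive.
have [c cI fE] := MVT zy (fun t _ => df t) cf.
rewrite -/(f y) -/(f z) fE normrM mulrC ler_wpM2l //.
apply: norm_expR2; move: cI; rewrite in_itv /= => /andP[? ?].
by move: yw zw; rewrite !ler_norml => /andP[? ?] /andP[? ?]; apply/andP; split; lra.
Qed.

Lemma norm_expR3 y w : `|y| <= w ->
  `|expR y - 1 - y - y ^+ 2 / 2| <= w ^+ 3 * expR w.
Proof.
move=> yw; have w0 : 0 <= w by exact: le_trans yw.
have := @norm_expRBBB y 0 w yw; rewrite normr0 expR0 expr0n /= !mul0r !subr0.
move=> /(_ w0); rewrite [1 - 1]subrr subr0 => /le_trans; apply.
by rewrite [w ^+ 3]exprS -mulrA ler_wpM2r // mulr_ge0 // ?expR_ge0 // exprn_ge0.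
Qed.

(** The denominator accounts for the merely linear growth of the right-hand side as [y] tends to
    minus infinity; near [0] the bound is quadratic. *)
Lemma expR_quadratic_ge y : y ^+ 2 / (4 * (1 + `|y|)) <= expR y - 1 - y.
Proof.
have n0 : 0 <= `|y| by [].
have d0 : 0 < 4 * (1 + `|y|) by lra.
rewrite ler_pdivrMr //.
(* For [y >= -2] the number [1 + y / 2] is nonnegative, so [1 + y / 2 <= expR (y / 2)] may be
   squared. Below [-2], the positivity of [expR y] leaves [-1 - y], which is large enough. *)
have [y2|y2] := leP (- 2) y.
  have E : expR y = expR (y / 2) ^+ 2 by rewrite expr2 -expRD; congr expR; lra.
  have h : y ^+ 2 / 4 <= expR y - 1 - y.
    by rewrite E; have := expR_ge1Dx (y / 2); have := expR_gt0 (y / 2); nra.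
  have := sqr_ge0 y; nra.
rewrite ltr0_norm; last by lra.
have := expR_gt0 y; nra.
Qed.

(* The tangent line at [k] to the convex function [1 / (1 + w)]. *)
Lemma inv1D_ge_tangent k w : 0 <= k -> 0 <= w ->
  (1 + 2 * k - w) / (1 + k) ^+ 2 <= (1 + w)^-1.
Proof.
move=> k0 w0.
rewrite ler_pdivrMr; last by rewrite exprn_gt0; lra.
rewrite [leRHS]mulrC ler_pdivlMr; last by lra.
have := sqr_ge0 (w - k); nra.
Qed.

(** The tangent bound turns the quotient of [expR_quadratic_ge] into a polynomial in [|y|], whose
    mean involves only second and third moments. The parameter [k] stays free until these moments
    are known. *)
Lemma expR_scaled_ge y s S k : 0 <= s <= S -> 0 <= k ->
  s ^+ 2 / (4 * (1 + k) ^+ 2) * ((1 + 2 * k) * y ^+ 2 - S * `|y| ^+ 3) <=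
  expR (s * y) - 1 - s * y.
Proof.
move=> /andP[s0 sS] k0; apply: le_trans (expR_quadratic_ge _).
have yge : 0 <= `|y| by [].
have Sy0 : 0 <= S * `|y| by apply: mulr_ge0; lra.
have h := inv1D_ge_tangent k0 Sy0.
have h2 : (1 + S * `|y|)^-1 <= (1 + `|s * y|)^-1.
  by rewrite lef_pV2 ?posrE ?normrM ?(ger0_norm s0); nra.
have E : `|y| ^+ 3 = `|y| * y ^+ 2 by rewrite exprS real_normK ?num_real.
rewrite E.
have -> : s ^+ 2 / (4 * (1 + k) ^+ 2) *
    ((1 + 2 * k) * y ^+ 2 - S * (`|y| * y ^+ 2)) =
    (s * y) ^+ 2 / 4 * ((1 + 2 * k - S * `|y|) / (1 + k) ^+ 2).
  by field; lra.
rewrite [in leRHS]invfM [leRHS]mulrA ler_wpM2l //; last exact: le_trans h2.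
by rewrite divr_ge0 ?sqr_ge0.
Qed.

Lemma expR_ge_sqr y : 0 <= y -> y ^+ 2 <= 6 * expR y.
Proof.
move=> y0; have E : expR y = expR (y / 2) ^+ 2.
  by rewrite expr2 -expRD; congr expR; lra.
by rewrite E; have := expR_ge1Dx (y / 2); nra.
Qed.

Lemma expR_ge_cube y : 0 <= y -> y ^+ 3 <= 27 * expR y.
Proof.
move=> y0; have E : expR y = expR (y / 3) ^+ 3.
  by rewrite -expRM_natl; congr expR; lra.
have h : y / 3 <= expR (y / 3) by have := expR_ge1Dx (y / 3); lra.
have : (y / 3) ^+ 3 <= expR (y / 3) ^+ 3 by apply: lerXn2r => //; rewrite nnegrE; lra.
by rewrite E; lra.
Qed.

(** Both bounds are [ln (p / q) <= p / q - 1], for the two orders of the points. *)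
Lemma lnB_bounds a b : 1 <= a -> 1 <= b -> b <= a ->
  (a - b) / a <= ln a - ln b <= (a - b) / b.
Proof.
move=> a1 b1 ba.
have a0 : 0 < a by lra.
have b0 : 0 < b by lra.
have h (p q : R) : 0 < p -> 0 < q -> ln p - ln q <= (p - q) / q.
  move=> p0 q0; rewrite -ln_div ?posrE // mulrBl divff ?gt_eqF //.
  have /le_ln1Dx : -1 < p / q - 1 by have := divr_gt0 p0 q0; lra.
  by rewrite [1 + _]addrC subrK.
have := h a b a0 b0; have := h b a b0 a0.
rewrite -(opprB a b) mulNr => ? ?.
by apply/andP; split; lra.
Qed.

Lemma norm_lnB_le a b : 1 <= a -> 1 <= b -> `|ln a - ln b| <= `|a - b|.
Proof.
wlog ba : a b / b <= a => [hw a1 b1|a1 b1].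
  have [/hw|/ltW/hw] := leP b a; first exact.
  by rewrite distrC [`|b - a|]distrC; exact.
have := lnB_bounds a1 b1 ba => /andP[h1 h2].
have h3 : 0 <= (a - b) / a by rewrite divr_ge0; lra.
have h4 : (a - b) / b <= a - b by rewrite ler_pdivrMr; nra.
by rewrite !ger0_norm; lra.
Qed.

(** The derivative [1 / t - 1] of [ln t - (t - 1)] lies between [-m] and [0] on [[1, 1 + m]]. The
    small factor [m] later supplies the additional power of the scale. *)
Lemma norm_lnBB_le a b m : 1 <= a <= 1 + m -> 1 <= b <= 1 + m ->
  `|(ln a - (a - 1)) - (ln b - (b - 1))| <= m * `|a - b|.
Proof.
wlog ba : a b / b <= a => [hw am bm|/andP[a1 am] /andP[b1 bm]].
  have [/hw|/ltW/hw] := leP b a; first exact.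
  by rewrite distrC [`|b - a|]distrC; exact.
have := lnB_bounds a1 b1 ba => /andP[h1 h2].
have h3 : (1 - m) * (a - b) <= (a - b) / a.
  have ma : 0 <= m * (a - 1) by rewrite mulr_ge0; lra.
  (* This quantity equals [m * (a - 1) + (1 + m - a)]. *)
  have am1 : 0 <= 1 - (1 - m) * a by lra.
  rewrite ler_pdivlMr; last by lra.
  have : 0 <= (a - b) * (1 - (1 - m) * a) by rewrite mulr_ge0; lra.
  lra.
have h4 : (a - b) / b <= a - b by rewrite ler_pdivrMr; nra.
have m0 : 0 <= m * (a - b) by rewrite mulr_ge0; lra.
by rewrite (ger0_norm (_ : 0 <= a - b)); [rewrite ler_norml; apply/andP; split|]; lra.
Qed.

Lemma ln_ge a : 1 <= a -> (a - 1) / a <= ln a.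
Proof.
move=> a1; have := lnB_bounds a1 (lexx 1) a1.
by rewrite ln1 subr0 => /andP[].
Qed.

Lemma ln_le_subr1 a : 1 <= a -> ln a <= a - 1.
Proof.
move=> a1; have := lnB_bounds a1 (lexx 1) a1.
by rewrite ln1 subr0 divr1 => /andP[].
Qed.

End real_inequalities.

(** * The scalar product and the norms on columns *)

Section dot_product.
Context {R : realType} {n : nat}.
Implicit Types (u v x : 'cV[R]_n) (a : R).

(** The l1 norm, dual to the sup norm that is written [|u|] on columns. *)
Definition abs_sum x : R := \sum_(i < n) `|x i 0|.

Lemma abs_sum_ge0 x : 0 <= abs_sum x.
Proof. exact: sumr_ge0. Qed.

Lemma cV_norm_entry_le x i : `|x i 0| <= `|x|.
Proof.
by rewrite [leRHS]/Num.norm /= mx_normrE; apply/bigmax_geP; right => /=; exists (i, 0).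
Qed.

Lemma dotpZl a u x : dotp (a *: u) x = a * dotp u x.
Proof. by rewrite /dotp big_distrr; apply: eq_bigr => i _; rewrite mxE /= mulrA. Qed.

Lemma dotpBl u v x : dotp (u - v) x = dotp u x - dotp v x.
Proof. by rewrite /dotp -sumrB; apply: eq_bigr => i _; rewrite !mxE mulrBl. Qed.

Lemma norm_dotp_le u x : `|dotp u x| <= `|u| * abs_sum x.
Proof.
rewrite /dotp /abs_sum (le_trans (ler_norm_sum _ _ _)) // big_distrr /=.
by apply: ler_sum => i _; rewrite normrM ler_wpM2r // cV_norm_entry_le.
Qed.

Lemma dotp_delta a (i : 'I_n) x : dotp (a *: delta_mx i 0) x = a * x i 0.
Proof.
rewrite dotpZl; congr (_ * _); rewrite /dotp (bigD1 i) //= mxE !eqxx mul1r.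
rewrite big1 ?addr0 // => j /negPf ji; by rewrite mxE ji mul0r.
Qed.

(** The square of each coordinate is one of the nonnegative terms that sum to [1]. This places the
    Euclidean sphere in the sup-norm ball, where all estimates are made. *)
Lemma unit_sphere_norm_le1 u : unit_sphere u -> `|u| <= 1.
Proof.
move=> u1; rewrite [leLHS]/Num.norm /= mx_normrE; apply/bigmax_leP; split=> //.
case=> i j _ /=; rewrite ord1 -(ler_pXn2r (n := 2)) ?nnegrE // expr1n real_normK ?num_real //.
have <- : dotp u u = 1.
  move: u1; rewrite /unit_sphere /= /enorm => u1.
  have d0 : 0 <= dotp u u by apply: sumr_ge0 => k _; rewrite -expr2 sqr_ge0.
  by rewrite -(sqr_sqrtr d0) u1 expr1n.
rewrite /dotp (bigD1 i) //= -expr2 lerDl.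
by apply: sumr_ge0 => k _; rewrite -expr2 sqr_ge0.
Qed.

(* Some coordinate satisfies [abs_sum x <= n * `|x i|]. *)
Lemma expR_abs_sum_le a x : (0 < n)%N -> 0 <= a ->
  expR (a * abs_sum x) <=
  \sum_(i < n) (expR (n%:R * a * x i 0) + expR (- (n%:R * a) * x i 0)).
Proof.
move=> n0 a0.
have [i xi] : exists i, abs_sum x <= n%:R * `|x i 0|.
  apply: contrapT => /forallNP h.
  have : \sum_(i < n) n%:R * `|x i 0| < \sum_(i < n) abs_sum x.
    apply: ltr_sum; last by move=> i _; rewrite ltNge; exact/negP/h.
    by apply/hasP; exists (Ordinal n0); rewrite ?mem_index_enum.
  by rewrite -big_distrr /= sumr_const card_ord mulr_natl ltxx.
have h : expR (a * abs_sum x) <= expR (n%:R * a * `|x i 0|).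
  by rewrite ler_expR mulrAC [leRHS]mulrC ler_wpM2l.
rewrite (le_trans h) // (bigD1 i) //=.
have [x0|x0] := leP 0 (x i 0).
  rewrite (ger0_norm x0) -addrA lerDl addr_ge0 ?expR_ge0 //.
  by apply: sumr_ge0 => j _; rewrite addr_ge0 ?expR_ge0.
rewrite (ltr0_norm x0) mulrN -mulNr addrAC lerDr addr_ge0 ?expR_ge0 //.
by apply: sumr_ge0 => j _; rewrite addr_ge0 ?expR_ge0.
Qed.

End dot_product.

(** * Integrability, moments and the moment generating function of [X] *)

Section moments.
Context {R : realType} {n : nat} {d : measure_display} {T : measurableType d}.
Variables (P : probability T R) (X : {RV P >-> n.-tuple R}).

Local Notation intg f := (P.-integrable setT (EFin \o f)).
Local Notation Ex f := (Rintegral P setT f).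

Definition proj (u : 'cV[R]_n) (w : T) : R := dotp u (vec (X w)).
Definition size1 (w : T) : R := abs_sum (vec (X w)).
Definition mgf (u : 'cV[R]_n) : R := Ex (fun w => expR (proj u w)).
Definition cgf (u : 'cV[R]_n) : R := ln (mgf u).
Definition var2 (u : 'cV[R]_n) : R := Ex (fun w => proj u w ^+ 2).

Lemma measurable_coord i : measurable_fun setT (fun w => tnth (X w) i).
Proof.
exact: (measurableT_comp (measurable_tnth i) (measurable_funPT X)).
Qed.

Lemma measurable_proj u : measurable_fun setT (proj u).
Proof.
apply: measurable_sum => i; apply: measurable_funM => //.
by under eq_fun do rewrite mxE; exact: measurable_coord.
Qed.

Lemma measurable_size1 : measurable_fun setT size1.
Proof.
apply: measurable_sum => i; apply: measurableT_comp => //.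
by under eq_fun do rewrite mxE; exact: measurable_coord.
Qed.

Lemma measurable_expR_size1 a : measurable_fun setT (fun w => expR (a * size1 w)).
Proof.
apply: measurableT_comp => //; apply: measurable_funM => //.
exact: measurable_size1.
Qed.

Hypothesis hn : (0 < n)%N.
Hypothesis hK : forall t : 'cV[R]_n, (cumulant X t < +oo)%E.

Lemma integrable_expR_proj u : intg (fun w => expR (proj u w)).
Proof.
apply/integrableP; split.
  by apply/measurable_EFinP/measurableT_comp => //; exact: measurable_proj.
have := hK u; rewrite /cumulant unlock.
have -> : (\int[P]_w (expR (dotp u (vec (X w))))%:E =
   \int[P]_w `|(EFin \o (fun w => expR (proj u w))) w|)%E.
  by apply: eq_integral => w _ /=; rewrite ger0_norm ?expR_ge0.
by case: (\int[P]_w _)%E => // r; rewrite ltry.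
Qed.

(** The majorant [g] is a sum of [2 n] exponentials along the coordinate axes, each integrable
    because the cumulant is finite everywhere. *)
Lemma integrable_expR_size1 a : 0 <= a -> intg (fun w => expR (a * size1 w)).
Proof.
move=> a0.
pose g w := \sum_(i < n) (expR (proj ((n%:R * a) *: delta_mx i 0) w) +
                          expR (proj (- (n%:R * a) *: delta_mx i 0) w)).
apply: (@le_integrable _ _ _ _ _ _ _ (EFin \o g)) => //.
- exact/measurable_EFinP/measurable_expR_size1.
- move=> w _ /=; rewrite lee_fin ger0_norm ?expR_ge0 // ger0_norm; last first.
    by apply: sumr_ge0 => i _; rewrite addr_ge0 ?expR_ge0.
  rewrite (le_trans (expR_abs_sum_le _ hn a0)) // /g /proj.
  by apply: ler_sum => i _; rewrite !dotp_delta.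
- rewrite (_ : EFin \o g = fun w => \sum_(i < n)
      ((expR (proj ((n%:R * a) *: delta_mx i 0) w))%:E +
       (expR (proj (- (n%:R * a) *: delta_mx i 0) w))%:E))%E; last first.
    by apply/funext => w /=; rewrite /g -sumEFin.
  apply: integrable_sum => // i _.
  by apply: integrableD => //; exact: integrable_expR_proj.
Qed.

Lemma dominated_integrable (f : T -> R) c a : measurable_fun setT f -> 0 <= a ->
  (forall w, `|f w| <= c * expR (a * size1 w)) -> intg f.
Proof.
move=> mf a0 fle.
have ig : intg (fun w => c * expR (a * size1 w)).
  by have := integrableZl measurableT c (integrable_expR_size1 a0).
apply: (le_integrable _ _ _ ig) => //; first exact/measurable_EFinP.
move=> w _ /=; rewrite lee_fin (le_trans (fle w)) //.
exact: ler_norm.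
Qed.

Lemma norm_proj_le u w : `|proj u w| <= `|u| * size1 w.
Proof. exact: norm_dotp_le. Qed.

Lemma size1_ge0 w : 0 <= size1 w.
Proof. exact: abs_sum_ge0. Qed.

Lemma norm_coord_le i w : `|tnth (X w) i| <= size1 w.
Proof.
rewrite /size1 /abs_sum (bigD1 i) //= mxE lerDl.
exact: sumr_ge0.
Qed.

Lemma size1_le w : size1 w <= expR (1 * size1 w).
Proof. by rewrite mul1r; have := expR_ge1Dx (size1 w); lra. Qed.

Lemma sqr_size1_le w : size1 w ^+ 2 <= 6 * expR (1 * size1 w).
Proof. by rewrite mul1r expR_ge_sqr ?size1_ge0. Qed.

Lemma cube_size1_le w : size1 w ^+ 3 <= 27 * expR (1 * size1 w).
Proof. by rewrite mul1r expR_ge_cube ?size1_ge0. Qed.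

Lemma integrable_coord i : intg (fun w => tnth (X w) i).
Proof.
apply: (@dominated_integrable _ 1 1) => //; first exact: measurable_coord.
by move=> w; rewrite mul1r (le_trans (norm_coord_le _ _)) // size1_le.
Qed.

Lemma integrable_coord2 i j : intg (fun w => tnth (X w) i * tnth (X w) j).
Proof.
apply: (@dominated_integrable _ 6 1) => //.
  by apply: measurable_funM; exact: measurable_coord.
move=> w; rewrite normrM (le_trans _ (sqr_size1_le w)) // expr2.
by apply: ler_pM => //; exact: norm_coord_le.
Qed.

Lemma Rintegral_sum (f : 'I_n -> T -> R) : (forall i, intg (f i)) ->
  Ex (fun w => \sum_(i < n) f i w) = \sum_(i < n) Ex (f i).
Proof.
move=> fi; rewrite /Rintegral.
under eq_integral do rewrite -sumEFin.
rewrite integral_sum //; apply/esym/sum_fine => i _.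
exact: (integrable_fin_num measurableT (fi i)).
Qed.

Hypothesis hcentered : centered X.

Lemma Rintegral_coord i : Ex (fun w => tnth (X w) i) = 0.
Proof. by have := hcentered i; rewrite unlock /Rintegral => ->. Qed.

Lemma Rintegral_proj u : Ex (proj u) = 0.
Proof.
rewrite (_ : proj u = fun w => \sum_(i < n) u i 0 * tnth (X w) i); last first.
  by apply/funext => w; apply: eq_bigr => i _; rewrite mxE.
rewrite Rintegral_sum.
  rewrite big1 // => i _; rewrite RintegralZl //; last exact: integrable_coord.
  by rewrite Rintegral_coord mulr0.
by move=> i; have := integrableZl measurableT (u i 0) (integrable_coord i).
Qed.

Lemma covmxE i j : covmx X i j = Ex (fun w => tnth (X w) i * tnth (X w) j).
Proof.
rewrite mxE unlock !hcentered unlock /Rintegral; congr fine.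
apply: eq_integral => w _; rewrite mulrfctE /=. by rewrite !subr0.
Qed.

(** Since [X] is centered, covariances are means of products; expanding the square of [proj u] gives
    the same double sum. *)
Lemma qvarE u : qvar X u = var2 u.
Proof.
rewrite /qvar /quad_form /var2 mxE.
under eq_bigr => j _ do rewrite mxE big_distrl /=.
rewrite exchange_big /=.
rewrite (_ : (fun w => proj u w ^+ 2) = fun w => \sum_(i < n) \sum_(j < n)
    (u i 0 * u j 0) * (tnth (X w) i * tnth (X w) j)); last first.
  apply/funext => w; rewrite /proj /dotp expr2 big_distrl /=.
  apply: eq_bigr => i _; rewrite big_distrr /=; apply: eq_bigr => j _.
  by rewrite !mxE; ring.
have ii i j : intg (fun w => (u i 0 * u j 0) * (tnth (X w) i * tnth (X w) j)).
  by have := integrableZl measurableT (u i 0 * u j 0) (integrable_coord2 i j).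
rewrite Rintegral_sum.
  apply: eq_bigr => i _; rewrite Rintegral_sum //; apply: eq_bigr => j _.
  rewrite RintegralZl //; last exact: integrable_coord2.
  by rewrite covmxE !mxE; ring.
move=> i.
rewrite (_ : EFin \o _ = fun w => \sum_(j < n)
  ((u i 0 * u j 0) * (tnth (X w) i * tnth (X w) j))%:E)%E; last first.
  by apply/funext => w /=; rewrite -sumEFin.
by apply: integrable_sum => // j _; exact: ii.
Qed.

Lemma projZ a u w : proj (a *: u) w = a * proj u w.
Proof. exact: dotpZl. Qed.

Lemma integrable_proj u : intg (proj u).
Proof.
apply: (@dominated_integrable _ `|u| 1) => //; first exact: measurable_proj.
move=> w; rewrite (le_trans (norm_proj_le _ _)) // ler_wpM2l //.
exact: size1_le.
Qed.

Lemma norm_projX_le k u w : `|proj u w| ^+ k <= `|u| ^+ k * size1 w ^+ k.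
Proof.
rewrite -exprMn; apply: lerXn2r; rewrite ?nnegrE //; last exact: norm_proj_le.
by rewrite mulr_ge0 // size1_ge0.
Qed.

Lemma integrable_proj2 u : intg (fun w => proj u w ^+ 2).
Proof.
apply: (@dominated_integrable _ (`|u| ^+ 2 * 6) 1) => //.
  by apply: measurable_funX; exact: measurable_proj.
move=> w; rewrite normrX (le_trans (norm_projX_le _ _ _)) // -[leRHS]mulrA.
by rewrite ler_wpM2l ?sqr_ge0 // sqr_size1_le.
Qed.

Lemma integrable_norm_proj3 u : intg (fun w => `|proj u w| ^+ 3).
Proof.
apply: (@dominated_integrable _ (`|u| ^+ 3 * 27) 1) => //.
  by apply: measurable_funX; apply: measurableT_comp => //; exact: measurable_proj.
move=> w; rewrite normrX normr_id (le_trans (norm_projX_le _ _ _)) // -[leRHS]mulrA.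
by rewrite ler_wpM2l ?exprn_ge0 // cube_size1_le.
Qed.

Lemma integrable_one : intg (fun=> 1 : R).
Proof. exact: finite_measure_integrable_cst. Qed.

Lemma Rintegral_one : Ex (fun=> 1 : R) = 1.
Proof. by have := expectation_cst P 1; rewrite unlock /Rintegral => ->. Qed.

Definition rem2 u w := expR (proj u w) - 1 - proj u w.
Definition rem3 u w := expR (proj u w) - 1 - proj u w - proj u w ^+ 2 / 2.

Lemma integrable_expR_proj_m1 u : intg (fun w => expR (proj u w) - 1).
Proof.
have := integrableB measurableT (integrable_expR_proj u) integrable_one.
exact.
Qed.

Lemma integrable_rem2 u : intg (rem2 u).
Proof.
have := integrableB measurableT (integrable_expR_proj_m1 u) (integrable_proj u).
exact.
Qed.

Lemma integrable_half_proj2 u : intg (fun w => proj u w ^+ 2 / 2).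
Proof.
have := integrableZr measurableT 2^-1 (integrable_proj2 u).
exact.
Qed.

Lemma integrable_rem3 u : intg (rem3 u).
Proof.
have := integrableB measurableT (integrable_rem2 u) (integrable_half_proj2 u).
exact.
Qed.

(** Centering removes the mean of the linear term, so [mgf u - 1] inherits the quadratic size of the
    remainder. *)
Lemma Rintegral_rem2 u : Ex (rem2 u) = mgf u - 1.
Proof.
rewrite /rem2 RintegralB //;
  [|exact: integrable_expR_proj_m1|exact: integrable_proj].
rewrite Rintegral_proj subr0 RintegralB //;
  [|exact: integrable_expR_proj|exact: integrable_one].
by rewrite Rintegral_one.
Qed.

Lemma Rintegral_rem3 u : Ex (rem3 u) = mgf u - 1 - var2 u / 2.
Proof.
rewrite -Rintegral_rem2 /rem3 RintegralB //;
  [|exact: integrable_rem2|exact: integrable_half_proj2].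
by rewrite RintegralZr //; exact: integrable_proj2.
Qed.

(** Jensen's inequality for a centered variable: the remainder [rem2 u] is pointwise nonnegative. *)
Lemma mgf_ge1 u : 1 <= mgf u.
Proof.
rewrite -subr_ge0 -Rintegral_rem2; apply: Rintegral_ge0 => w _.
by rewrite /rem2; have := expR_ge1Dx (proj u w); lra.
Qed.

Lemma cumulantE u : cumulant X u = (cgf u)%:E.
Proof.
rewrite /cumulant -lne_EFin; last by have := mgf_ge1 u; lra.
congr lne; rewrite unlock /mgf /Rintegral fineK //.
apply: integrable_fin_num => //; exact: integrable_expR_proj.
Qed.

Lemma var2Z a u : var2 (a *: u) = a ^+ 2 * var2 u.
Proof.
rewrite /var2 -RintegralZl //; last exact: integrable_proj2.
by apply: eq_Rintegral => w _; rewrite projZ exprMn.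
Qed.

(* The constant 27 makes the weight dominate both [size1 w ^+ 2 * expR (S * size1 w)]
   and [size1 w ^+ 3 * expR (S * size1 w)]. *)
Definition weight S w : R := 27 * expR ((1 + S) * size1 w).
Definition weight_mean S : R := Ex (weight S).

Lemma integrable_weight S : 0 <= S -> intg (weight S).
Proof.
move=> S0; apply: (@dominated_integrable _ 27 (1 + S)) => //; last 2 first.
- lra.
- by move=> w; rewrite ger0_norm // mulr_ge0 ?expR_ge0.
by apply: measurable_funM => //; exact: measurable_expR_size1.
Qed.

Lemma weight_mean_ge0 S : 0 <= weight_mean S.
Proof. by apply: Rintegral_ge0 => w _; rewrite mulr_ge0 ?expR_ge0. Qed.

Lemma sqr_size1_le_weight s S w : s <= S ->
  size1 w ^+ 2 * expR (s * size1 w) <= weight S w.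
Proof.
move=> sS; rewrite /weight [(1 + S) * _]mulrDl expRD mulrA ler_pM ?sqr_ge0 ?expR_ge0 //.
  have := sqr_size1_le w; have := expR_ge0 (1 * size1 w); lra.
by rewrite ler_expR ler_wpM2r // size1_ge0.
Qed.

Lemma cube_size1_le_weight s S w : s <= S ->
  size1 w ^+ 3 * expR (s * size1 w) <= weight S w.
Proof.
move=> sS; rewrite /weight [(1 + S) * _]mulrDl expRD mulrA ler_pM ?expR_ge0 //.
- by rewrite exprn_ge0 // size1_ge0.
- exact: cube_size1_le.
by rewrite ler_expR ler_wpM2r // size1_ge0.
Qed.

Lemma Rintegral_dominated_by_weight (f : T -> R) k S : 0 <= S -> intg f ->
  (forall w, `|f w| <= k * weight S w) -> `|Ex f| <= k * weight_mean S.
Proof.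
move=> S0 fi fle; rewrite (le_trans (le_normr_Rintegral _ fi)) //.
rewrite -RintegralZl //; last exact: integrable_weight.
apply: le_Rintegral => //.
- have := integrable_norm fi; exact.
- by have := integrableZl measurableT k (integrable_weight S0).
Qed.

(** * Taylor estimates for the moment generating function, uniform in the scale [s <= S] and in the
    direction *)

Section bounds.
Variables (S s : R) (u v : 'cV[R]_n).
Hypotheses (s0 : 0 <= s) (sS : s <= S) (u1 : `|u| <= 1) (v1 : `|v| <= 1).

Let S0 : 0 <= S. Proof. exact: le_trans sS. Qed.

Lemma norm_projZ_le (x : 'cV[R]_n) w : `|x| <= 1 -> `|proj (s *: x) w| <= s * size1 w.
Proof.
move=> x1; rewrite projZ normrM (ger0_norm s0) ler_wpM2l //.
by rewrite (le_trans (norm_proj_le _ _)) // ler_piMl ?size1_ge0.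
Qed.

Lemma norm_projZB_le w :
  `|proj (s *: u) w - proj (s *: v) w| <= s * (`|u - v| * size1 w).
Proof.
rewrite !projZ -mulrBr normrM (ger0_norm s0) ler_wpM2l //.
by rewrite /proj -dotpBl norm_dotp_le.
Qed.

Lemma mgf_bound : mgf (s *: u) - 1 <= s ^+ 2 * weight_mean S.
Proof.
rewrite -Rintegral_rem2; apply: le_trans (ler_norm _) _.
apply: Rintegral_dominated_by_weight => //; first exact: integrable_rem2.
move=> w; rewrite (le_trans (norm_expR2 (norm_projZ_le w u1))) //.
by rewrite exprMn -mulrA ler_wpM2l ?sqr_ge0 // sqr_size1_le_weight.
Qed.

Lemma mgf_bound3 :
  `|mgf (s *: u) - 1 - s ^+ 2 * var2 u / 2| <= s ^+ 3 * weight_mean S.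
Proof.
rewrite -var2Z -Rintegral_rem3.
apply: Rintegral_dominated_by_weight => //; first exact: integrable_rem3.
move=> w; rewrite (le_trans (norm_expR3 (norm_projZ_le w u1))) //.
by rewrite exprMn -mulrA ler_wpM2l ?exprn_ge0 // cube_size1_le_weight.
Qed.

(** The Lipschitz estimate for the pointwise remainders yields one factor [|u - v|] and two powers
    of [s]; the rest is below [weight S]. The third-order analogue gains one more power of [s]. *)
Lemma mgfB_bound :
  `|mgf (s *: u) - mgf (s *: v)| <= s ^+ 2 * `|u - v| * weight_mean S.
Proof.
have -> : mgf (s *: u) - mgf (s *: v) = Ex (rem2 (s *: u)) - Ex (rem2 (s *: v)).
  by rewrite (Rintegral_rem2 (s *: u)) (Rintegral_rem2 (s *: v)) opprB addrA subrK.
have iu := integrable_rem2 (s *: u); have iv := integrable_rem2 (s *: v).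
rewrite -RintegralB //; apply: Rintegral_dominated_by_weight => //.
  by have := integrableB measurableT iu iv.
move=> w.
rewrite (le_trans (norm_expRBB (norm_projZ_le w u1) (norm_projZ_le w v1))) //.
apply: (@le_trans _ _ (s * (`|u - v| * size1 w) * (s * size1 w * expR (s * size1 w)))).
  rewrite ler_wpM2r ?norm_projZB_le // !mulr_ge0 ?expR_ge0 ?size1_ge0 //.
have -> : s * (`|u - v| * size1 w) * (s * size1 w * expR (s * size1 w)) =
  s ^+ 2 * `|u - v| * (size1 w ^+ 2 * expR (s * size1 w)) by ring.
by rewrite ler_wpM2l ?sqr_size1_le_weight // mulr_ge0 ?sqr_ge0.
Qed.

Lemma mgfB_bound3 :
  `|(mgf (s *: u) - 1 - s ^+ 2 * var2 u / 2) -
    (mgf (s *: v) - 1 - s ^+ 2 * var2 v / 2)| <= s ^+ 3 * `|u - v| * weight_mean S.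
Proof.
have -> : mgf (s *: u) - 1 - s ^+ 2 * var2 u / 2 -
    (mgf (s *: v) - 1 - s ^+ 2 * var2 v / 2) =
    Ex (rem3 (s *: u)) - Ex (rem3 (s *: v)).
  by congr (_ - _); rewrite Rintegral_rem3 var2Z.
have iu := integrable_rem3 (s *: u); have iv := integrable_rem3 (s *: v).
rewrite -RintegralB //; apply: Rintegral_dominated_by_weight => //.
  by have := integrableB measurableT iu iv.
move=> w.
rewrite (le_trans (norm_expRBBB (norm_projZ_le w u1) (norm_projZ_le w v1))) //.
apply: (@le_trans _ _
    (s * (`|u - v| * size1 w) * ((s * size1 w) ^+ 2 * expR (s * size1 w)))).
  by rewrite ler_wpM2r ?norm_projZB_le // mulr_ge0 ?expR_ge0 ?sqr_ge0.
have -> : s * (`|u - v| * size1 w) * ((s * size1 w) ^+ 2 * expR (s * size1 w)) =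
  s ^+ 3 * `|u - v| * (size1 w ^+ 3 * expR (s * size1 w)) by ring.
by rewrite ler_wpM2l ?cube_size1_le_weight // mulr_ge0 ?exprn_ge0.
Qed.

End bounds.

(** Obtained by integrating [expR_scaled_ge] at [y = proj u w]. *)
Lemma mgf_quadratic_lower_bound u S : 0 <= S -> 0 < var2 u ->
  exists2 b, 0 < b &
    forall s, 0 <= s <= S -> b * s ^+ 2 <= mgf (s *: u) - 1.
Proof.
move=> S0 V0; pose W := Ex (fun w => `|proj u w| ^+ 3).
have W0 : 0 <= W by apply: Rintegral_ge0 => w _; exact: exprn_ge0.
(* With this choice [2 * k * var2 u = S * W], so the third moment cancels and the numerator of the
   witness below is exactly [var2 u]. *)
pose k := S * W / (2 * var2 u).
have k0 : 0 <= k by rewrite divr_ge0 ?mulr_ge0 //; lra.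
exists (((1 + 2 * k) * var2 u - S * W) / (4 * (1 + k) ^+ 2)).
  have -> : (1 + 2 * k) * var2 u - S * W = var2 u by rewrite /k; field; lra.
  by rewrite divr_gt0 // mulr_gt0 // exprn_gt0; lra.
move=> s sS; rewrite -Rintegral_rem2.
pose c := s ^+ 2 / (4 * (1 + k) ^+ 2).
have i2 : intg (fun w => (1 + 2 * k) * proj u w ^+ 2).
  by have := integrableZl measurableT (1 + 2 * k) (integrable_proj2 u).
have i3 : intg (fun w => S * `|proj u w| ^+ 3).
  by have := integrableZl measurableT S (integrable_norm_proj3 u).
have iB : intg (fun w => (1 + 2 * k) * proj u w ^+ 2 - S * `|proj u w| ^+ 3).
  by have := integrableB measurableT i2 i3.
have -> : ((1 + 2 * k) * var2 u - S * W) / (4 * (1 + k) ^+ 2) * s ^+ 2 =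
  Ex (fun w => c * ((1 + 2 * k) * proj u w ^+ 2 - S * `|proj u w| ^+ 3)).
  rewrite RintegralZl // RintegralB // RintegralZl //; last exact: integrable_proj2.
  rewrite RintegralZl //; last exact: integrable_norm_proj3.
  by rewrite /c /var2 -/W; ring.
apply: le_Rintegral => //.
- by have := integrableZl measurableT c iB.
- exact: integrable_rem2.
by move=> w _; rewrite /rem2 projZ; exact: expR_scaled_ge.
Qed.

End moments.

(** One half of a comparison: used in both directions, it shows that two infima differ by at most
    [e]. *)
Lemma inf_le_infD {R : realType} (A B : set R) (e : R) :
  A !=set0 -> has_lbound B -> (forall c, A c -> B (c + e)) ->
  inf B <= inf A + e.
Proof.
move=> A0 lB AB; rewrite -lerBlDr; apply: lb_le_inf => // c Ac.
by rewrite lerBlDr; apply: ge_inf => //; exact: AB.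
Qed.

(** * Arithmetic of the cleared pole constraint at a single scale [s] *)

Section pole_arithmetic.
Context {R : realType}.
Implicit Types (b c e k s w D L : R).

Lemma exists_small_radius L c b e : 0 <= L -> 0 <= c -> 0 < b -> 0 < e ->
  exists2 r, 0 < r & forall D, 0 <= D -> D < 2 * r ->
    D * L <= b / 2 /\ D * (L * (c + 1)) <= e * (b / 2).
Proof.
(* The minimum serves both conclusions: [b * m <= b] for the first and [b * m <= b * e] for the
   second. The [2 * r] in the statement is the largest distance between two directions within [r] of
   a third. *)
move=> L0 c0 b0 e0; pose m := Num.min e 1.
have m0 : 0 < m by rewrite lt_min e0 ltr01.
have me : m <= e by rewrite ge_min lexx.
have m1 : m <= 1 by rewrite ge_min lexx orbT.
have q0 : 0 < (L + 1) * (c + 1) by rewrite mulr_gt0; lra.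
clearbody m; exists (b * m / (4 * ((L + 1) * (c + 1)))).
  by rewrite divr_gt0 // mulr_gt0.
move=> D D0.
have -> : 2 * (b * m / (4 * ((L + 1) * (c + 1)))) =
    (b * m / 2) / ((L + 1) * (c + 1)) by field; lra.
rewrite ltr_pdivlMr // => Dlt.
have DL0 := mulr_ge0 D0 L0; have Dc0 := mulr_ge0 D0 c0; have DLc0 := mulr_ge0 DL0 c0.
have bm : b * m <= b * 1 by rewrite ler_wpM2l // ltW.
have be : b * m <= b * e by rewrite ler_wpM2l // ltW.
split; lra.
Qed.

(** Changing the direction costs at most half of the quadratic lower bound. *)
Lemma quadratic_bound_transfer s D L b k k0 : D * L <= b / 2 ->
  b * s ^+ 2 <= k0 -> `|k - k0| <= s ^+ 2 * D * L -> b / 2 * s ^+ 2 <= k.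
Proof.
move=> DL h; rewrite ler_norml => /andP[h1 _].
have : s ^+ 2 * (D * L) <= s ^+ 2 * (b / 2) by rewrite ler_wpM2l ?sqr_ge0.
lra.
Qed.

Lemma constraint_of_ge1 s c k w : 0 <= k -> 0 <= w -> 1 <= c * s ->
  k - w / 2 <= c * s * k.
Proof. by move=> k0 w0 /(ler_wpM2r k0); rewrite mul1r; lra. Qed.

(** The cubic error is [2 * L / b * s] times the quadratic lower bound on [k]. This produces an
    admissible value without knowing one in advance. *)
Lemma constraint_of_cubic_bound s c L b k x : 0 < b -> 0 < s -> 0 <= L ->
  2 * L / b <= c -> b / 2 * s ^+ 2 <= k -> x <= s ^+ 3 * L -> x <= c * s * k.
Proof.
move=> b0 s0 L0 Lc kb xL; apply: (le_trans xL).
have -> : s ^+ 3 * L = 2 * L / b * s * (b / 2 * s ^+ 2) by field; rewrite gt_eqF.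
have Lb0 : 0 <= 2 * L / b by rewrite divr_ge0 ?mulr_ge0 // ltW.
apply: ler_pM => //.
- by rewrite mulr_ge0 // ltW.
- by rewrite mulr_ge0 ?sqr_ge0 // divr_ge0 // ltW.
- by rewrite ler_wpM2r // ltW.
Qed.

(** Replacing [k, w] by [k', w'] costs [s ^+ 3 * D * L] on the left and at most
    [c0 * s * (s ^+ 2 * D * L)] on the right. The extra term [e * s * k'] is at least
    [e * (b / 2) * s ^+ 3], which pays for both. *)
Lemma constraint_transfer s D L b c c0 e k k' w w' :
  0 < s -> 0 <= D -> 0 <= L -> 0 <= e -> 0 <= c <= c0 ->
  D * (L * (c0 + 1)) <= e * (b / 2) ->
  `|k' - k| <= s ^+ 2 * D * L -> `|(k' - w') - (k - w)| <= s ^+ 3 * D * L ->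
  b / 2 * s ^+ 2 <= k' -> k - w <= c * s * k -> k' - w' <= (c + e) * s * k'.
Proof.
move=> s0 D0 L0 e0 /andP[cge0 cc0] Dle.
rewrite !ler_norml => /andP[h1 _] /andP[_ h2] lb h.
have cs0 : 0 <= c * s by rewrite mulr_ge0 // ltW.
have DL0 : 0 <= s ^+ 2 * D * L by rewrite mulr_ge0 // mulr_ge0 // sqr_ge0.
have k1 : c * s * (k - k') <= c0 * s * (s ^+ 2 * D * L).
  apply: (@le_trans _ _ (c * s * (s ^+ 2 * D * L))).
    by rewrite ler_wpM2l //; lra.
  by rewrite ler_wpM2r // ler_wpM2r // ltW.
have k2 : s ^+ 3 * (D * (L * (c0 + 1))) <= s ^+ 3 * (e * (b / 2)).
  by rewrite ler_wpM2l // exprn_ge0 // ltW.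
have k3 : e * s * (b / 2 * s ^+ 2) <= e * s * k'.
  by rewrite ler_wpM2l // mulr_ge0 // ltW.
have E3 : e * s * (b / 2 * s ^+ 2) = s ^+ 3 * (e * (b / 2)) by ring.
have E2 : s ^+ 3 * (D * (L * (c0 + 1))) = c0 * s * (s ^+ 2 * D * L) + s ^+ 3 * D * L.
  by ring.
rewrite E3 in k3; rewrite E2 in k2; rewrite mulrBr in k1; rewrite !mulrDl.
lra.
Qed.

End pole_arithmetic.

(** * The cumulant generating function and the set of admissible poles *)

Section pole.
Context {R : realType} {n : nat} {d : measure_display} {T : measurableType d}.
Variables (P : probability T R) (X : {RV P >-> n.-tuple R}).
Hypothesis hn : (0 < n)%N.
Hypothesis hK : forall t : 'cV[R]_n, (cumulant X t < +oo)%E.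
Hypothesis hcentered : centered X.

Local Notation K := (cgf X).
Local Notation V := (var2 X).

Lemma cgf_ge0 u : 0 <= K u.
Proof. by rewrite ln_ge0 // mgf_ge1. Qed.

Lemma var2_ge0 u : 0 <= V u.
Proof. by apply: Rintegral_ge0 => w _; exact: sqr_ge0. Qed.

(** The estimates for [mgf] pass through the logarithm, because [ln M - (M - 1)] is of second order
    in [M - 1], hence of order [s ^+ 4]. *)
Lemma cgf_bounds S : 0 <= S -> exists2 L, 0 <= L &
  forall s (u v : 'cV[R]_n), 0 <= s <= S -> `|u| <= 1 -> `|v| <= 1 ->
  [/\ `|K (s *: u) - K (s *: v)| <= s ^+ 2 * `|u - v| * L,
      `|(K (s *: u) - s ^+ 2 * V u / 2) - (K (s *: v) - s ^+ 2 * V v / 2)| <=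
        s ^+ 3 * `|u - v| * L &
      K (s *: u) - s ^+ 2 * V u / 2 <= s ^+ 3 * L].
Proof.
move=> S0; pose W := weight_mean X S.
have W0 : 0 <= W := weight_mean_ge0 X S.
have SW0 : 0 <= S * W ^+ 2 by rewrite mulr_ge0 ?sqr_ge0.
(* The term [S * W ^+ 2] pays for the logarithmic correction, whose fourth power of [s] is reduced
   to a cube by [s <= S]. *)
exists (W + S * W ^+ 2); first by rewrite addr_ge0.
move=> s u v /andP[s0 sS] u1 v1.
set M := mgf X (s *: u); set M' := mgf X (s *: v).
have M1 : 1 <= M by exact: mgf_ge1.
have M1' : 1 <= M' by exact: mgf_ge1.
have MM : `|M - M'| <= s ^+ 2 * `|u - v| * W by exact: mgfB_bound.
have MM3 := mgfB_bound3 hn hK hcentered s0 sS u1 v1.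
have Mm : M - 1 <= s ^+ 2 * W by exact: mgf_bound.
have Mm' : M' - 1 <= s ^+ 2 * W by exact: mgf_bound.
have M3 := mgf_bound3 hn hK hcentered s0 sS u1.
rewrite -/M in M3; rewrite -/M -/M' -/W in MM3.
have s2 : 0 <= s ^+ 2 by exact: sqr_ge0.
have s3 : 0 <= s ^+ 3 by exact: exprn_ge0.
split.
- rewrite (le_trans (norm_lnB_le M1 M1')) // (le_trans MM) //.
  by rewrite ler_wpM2l ?mulr_ge0 // lerDl.
- have -> : K (s *: u) - s ^+ 2 * V u / 2 - (K (s *: v) - s ^+ 2 * V v / 2) =
      (M - 1 - s ^+ 2 * V u / 2 - (M' - 1 - s ^+ 2 * V v / 2)) +
      ((ln M - (M - 1)) - (ln M' - (M' - 1))).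
    have split_ln (x y p q k l : R) : x - p - (y - q) =
      (k - 1 - p - (l - 1 - q)) + ((x - (k - 1)) - (y - (l - 1))) by ring.
    exact: split_ln.
  have bM : 1 <= M <= 1 + s ^+ 2 * W by rewrite M1 /=; lra.
  have bM' : 1 <= M' <= 1 + s ^+ 2 * W by rewrite M1' /=; lra.
  have LL := norm_lnBB_le bM bM'.
  apply: le_trans (ler_normD _ _) _; rewrite mulrDr lerD //.
  apply: le_trans LL _.
  apply: (@le_trans _ _ (s ^+ 2 * W * (s ^+ 2 * `|u - v| * W))).
    by rewrite ler_wpM2l // mulr_ge0.
  have -> : s ^+ 2 * W * (s ^+ 2 * `|u - v| * W) =
    s ^+ 3 * `|u - v| * (s * W ^+ 2) by ring.
  by rewrite ler_wpM2l ?mulr_ge0 // ler_wpM2r // sqr_ge0.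
- have := ln_le_subr1 M1; move: M3; rewrite ler_norml /cgf -/M => /andP[_ M3] lnM.
  have : 0 <= s ^+ 3 * (S * W ^+ 2) by exact: mulr_ge0.
  by rewrite -/W in M3; lra.
Qed.

(** By [ln M >= (M - 1) / M], the bound for [mgf] loses only the factor [M], which is at most
    [1 + S ^+ 2 * W] for [s <= S]. *)
Lemma cgf_quadratic_lower_bound (u : 'cV[R]_n) S : 0 <= S -> `|u| <= 1 -> 0 < V u ->
  exists2 b, 0 < b & forall s, 0 <= s <= S -> b * s ^+ 2 <= K (s *: u).
Proof.
move=> S0 u1 V0.
have [b b0 hb] := mgf_quadratic_lower_bound hn hK hcentered S0 V0.
pose W := weight_mean X S.
have W0 : 0 <= W := weight_mean_ge0 X S.
have B0 : 0 < 1 + S ^+ 2 * W by have := mulr_ge0 (sqr_ge0 S) W0; lra.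
exists (b / (1 + S ^+ 2 * W)); first exact: divr_gt0.
move=> s sS; have := hb s sS; have /andP[s0 s1] := sS.
have M1 := mgf_ge1 hn hK hcentered (s *: u).
have Mm := mgf_bound hn hK hcentered s0 s1 u1; rewrite -/W in Mm.
have := ln_ge M1; rewrite -/(K (s *: u)).
set M := mgf X (s *: u) in M1 Mm * => h1 h2.
apply: le_trans h1; rewrite mulrAC.
apply: ler_pM => //.
- by rewrite mulr_ge0 ?sqr_ge0 // ltW.
- by rewrite invr_ge0 ltW.
rewrite lef_pV2 ?posrE //; last by lra.
have : s ^+ 2 * W <= S ^+ 2 * W.
  by rewrite ler_wpM2r // lerXn2r // nnegrE.
lra.
Qed.

(* The constraint defining [radial_pole], with the denominator cleared; it is
   then required for all [s > 0] since it is automatic once [1 <= c * s]. *)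
Definition pole_set (u : 'cV[R]_n) : set R := [set c | 0 <= c /\
  forall s, 0 < s -> K (s *: u) - s ^+ 2 * V u / 2 <= c * s * K (s *: u)].

Lemma pole_setE u : 0 < V u ->
  [set c : R | 0 <= c /\ forall s : R, 0 <= s -> (s%:E < c%:E^-1)%E ->
     (cumulant X (s *: u) <=
       (qvar X u * s ^+ 2 / (2 * (1 - c * s)))%:E)%E] = pole_set u.
Proof.
move=> V0; apply/seteqP; split=> c /= [c0 h]; split=> // s s0.
- have V2 : 0 <= s ^+ 2 * V u by rewrite mulr_ge0 ?sqr_ge0 // ltW.
  have K0 := cgf_ge0 (s *: u).
  (* At and beyond the pole the original definition requires nothing; the cleared inequality then
     follows from [K >= 0] and [V >= 0]. *)
  have [cs|cs] := leP 1 (c * s).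
    have : 1 * K (s *: u) <= c * s * K (s *: u) by rewrite ler_wpM2r.
    lra.
  have sc : (s%:E < c%:E^-1)%E.
    have [->|cn0] := eqVneq c 0; first by rewrite inve0 ltry.
    have cp : 0 < c by rewrite lt_neqAle eq_sym cn0.
    by rewrite inver gt_eqF // lte_fin -[_^-1]mul1r ltr_pdivlMr // mulrC.
  have := h s (ltW s0) sc; rewrite cumulantE // qvarE // lee_fin.
  rewrite ler_pdivlMr; last by lra.
  lra.
- have V2 : 0 <= s ^+ 2 * V u by rewrite mulr_ge0 ?sqr_ge0 // ltW.
  rewrite cumulantE // qvarE // lee_fin => sc.
  have cs : c * s < 1.
    move: sc; have [->|cn0] := eqVneq c 0; first by rewrite mul0r.
    have cp : 0 < c by rewrite lt_neqAle eq_sym cn0.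
    by rewrite inver gt_eqF // lte_fin -[_^-1]mul1r ltr_pdivlMr // mulrC.
  rewrite ler_pdivlMr; last by lra.
  (* The original constraint includes [s = 0], where both sides vanish because [mgf X 0 = 1]. *)
  have [s_eq0|sn0] := eqVneq s 0.
    rewrite s_eq0 scale0r /cgf.
    have -> : mgf X 0 = 1.
      rewrite -[RHS](Rintegral_one P); apply: eq_Rintegral => w _.
      by rewrite -(scale0r 0) projZ mul0r expR0.
    by rewrite ln1 expr0n /= !mulr0 !mul0r.
  have := h s; rewrite lt_neqAle eq_sym sn0 s0 => /(_ isT).
  lra.
Qed.

Lemma pole_set_lbound u : has_lbound (pole_set u).
Proof. by exists 0 => c []. Qed.

Lemma radial_poleE u : 0 < V u -> pole_set u !=set0 ->
  radial_pole X u = (inf (pole_set u))%:E.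
Proof.
move=> V0 A0; rewrite /radial_pole [in X in if X then _ else _]qvarE // V0 pole_setE //.
by rewrite -ereal_inf_EFin //; exact: pole_set_lbound.
Qed.

Lemma pole_set_up u c c' : c <= c' -> pole_set u c -> pole_set u c'.
Proof.
move=> cc [c0 h]; split=> [|s s0]; first exact: le_trans cc.
apply: le_trans (h s s0) _.
by rewrite ler_wpM2r ?cgf_ge0 // ler_wpM2r // ltW.
Qed.

(* For [s >= e^-1] the value [e] alone satisfies the constraint; for
   [s <= e^-1] the constraint, divided by [s ^+ 3], varies in a Lipschitz way
   with the direction while [K (s *: v) / s ^+ 2] stays away from [0]. *)
Lemma pole_set_perturbation (u0 : 'cV[R]_n) e : `|u0| <= 1 -> 0 < V u0 -> 0 < e ->
  exists2 r, 0 < r & forall v, `|v| <= 1 -> `|v - u0| < r ->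
    pole_set v !=set0 /\ forall v', `|v'| <= 1 -> `|v' - u0| < r ->
      forall c, pole_set v c -> pole_set v' (c + e).
Proof.
move=> u01 V0 e0; pose S := e^-1.
have S0 : 0 < S by rewrite invr_gt0.
have eS : e * S = 1 by rewrite mulfV // gt_eqF.
have [L L0 hL] := cgf_bounds (ltW S0).
have [b b0 hb] := cgf_quadratic_lower_bound (ltW S0) u01 V0.
(* The value [c0] is admissible for every direction near [u0]: [e <= c0] handles [s >= S], and
   [2 * L / b <= c0] handles [s <= S]. *)
have [c0 ec0 Lc0] : exists2 c0, e <= c0 & 2 * L / b <= c0.
  by exists (Num.max e (2 * L / b)); rewrite le_max lexx ?orbT.
have c00 : 0 <= c0 by rewrite (le_trans (ltW e0)).
have [r r0 hr] := exists_small_radius L0 c00 b0 e0.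
have r2 : r <= 2 * r by rewrite ler_peMl ?ltW // ltr1n.
clearbody S; exists r; first exact: r0.
have lowb v s : `|v| <= 1 -> `|v - u0| < r -> 0 < s -> s <= S ->
    b / 2 * s ^+ 2 <= K (s *: v).
  move=> v1 vr s0 sS; have s0S : 0 <= s <= S by rewrite (ltW s0).
  have [h _ _] := hL s v u0 s0S v1 u01.
  have [DL _] := hr _ (normr_ge0 _) (lt_le_trans vr r2).
  exact: quadratic_bound_transfer DL (hb s s0S) h.
have far v s c : e <= c -> 0 < s -> S <= s ->
    K (s *: v) - s ^+ 2 * V v / 2 <= c * s * K (s *: v).
  move=> ec s0 Ss; apply: constraint_of_ge1; first exact: cgf_ge0.
    by rewrite mulr_ge0 ?sqr_ge0 // var2_ge0.
  rewrite -eS (@le_trans _ _ (e * s)) //.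
    by rewrite ler_wpM2l // ltW.
  by rewrite ler_wpM2r // ltW.
have c0in v : `|v| <= 1 -> `|v - u0| < r -> pole_set v c0.
  move=> v1 vr; split=> // s s0.
  have [sS|/ltW Ss] := leP s S; last exact: far.
  have s0S : 0 <= s <= S by rewrite (ltW s0).
  have [_ _ h3] := hL s v v s0S v1 v1.
  exact: constraint_of_cubic_bound (lowb v s v1 vr s0 sS) h3.
move=> v v1 vr; split=> [|v' v1' vr' c vc]; first by exists c0; exact: c0in.
(* The radius [r] depends on [c0] but not on [c], so the transfer covers only [c <= c0]. A larger
   [c] gives [c + e >= c0], which is admissible by monotonicity. *)
have [cc0|/ltW c0c] := leP c c0; last first.
  by apply: pole_set_up (c0in v' v1' vr'); rewrite (le_trans c0c) // lerDl ltW.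
have [cge0 hc] := vc; split=> [|s s0]; first by rewrite addr_ge0 // ltW.
have [sS|/ltW Ss] := leP s S; last by apply: far => //; rewrite lerDr.
have s0S : 0 <= s <= S by rewrite (ltW s0).
have [h1 h2 _] := hL s v' v s0S v1' v1.
have D2r : `|v' - v| < 2 * r.
  rewrite -[v' - v](subrKA u0) (le_lt_trans (ler_normD _ _)) //.
  by rewrite [`|u0 - v|]distrC mulr_natl mulr2n ltrD.
have [_ Dle] := hr _ (normr_ge0 _) D2r.
apply: constraint_transfer Dle h1 h2 (lowb v' s v1' vr' s0 sS) (hc s s0) => //.
- exact: ltW.
- by rewrite cge0.
Qed.

(** * Finiteness and continuity on the unit sphere *)

Hypothesis hpos : forall u : 'cV[R]_n, unit_sphere u -> 0 < V u.

Lemma pole_set_neq0 u : unit_sphere u -> pole_set u !=set0.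
Proof.
move=> u1; have un := unit_sphere_norm_le1 u1.
have [r r0 /(_ u un)] := pole_set_perturbation un (hpos u1) ltr01.
by rewrite subrr normr0 => /(_ r0)[].
Qed.

Lemma radial_pole_sphereE u : unit_sphere u ->
  radial_pole X u = (inf (pole_set u))%:E.
Proof. by move=> u1; rewrite radial_poleE ?hpos //; exact: pole_set_neq0. Qed.

Lemma radial_pole_continuous :
  {within unit_sphere, continuous (radial_pole X : 'cV[R]_n -> \bar R)}.
Proof.
apply/subspace_continuousP => u u1.
have un := unit_sphere_norm_le1 u1.
rewrite /from_subspace radial_pole_sphereE //.
(* On the sphere the pole is a real infimum, so the limit can be taken in the reals. *)
apply: (@cvg_trans _ ((EFin \o (inf \o pole_set)) @ within unit_sphere (nbhs u))).
  apply: near_eq_cvg; apply: filterS (withinT _ _) => // v v1.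
  by rewrite /= radial_pole_sphereE.
apply: cvg_EFin; first by near=> v.
apply/cvgrPdist_le => e e0 /=.
have [r r0 hr] := pole_set_perturbation un (hpos u1) e0.
near=> v.
have v1 : unit_sphere v by near: v; exact: withinT.
have vn := unit_sphere_norm_le1 v1.
have vr : `|v - u| < r.
  near: v; apply: cvg_within; apply/nbhs_ballP; exists r => //= v.
  by rewrite mx_norm_ball /ball_ /= distrC.
have ur : `|u - u| < r by rewrite subrr normr0.
(* The perturbation result is symmetric in its two directions; using it from [v] to [u] and from [u]
   to [v] bounds the difference of the infima on both sides. *)
have [A0 hA] := hr v vn vr; have [B0 hB] := hr u un ur.
have h1 := inf_le_infD A0 (pole_set_lbound u) (hA u un ur).
have h2 := inf_le_infD B0 (pole_set_lbound v) (hB v vn vr).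
by rewrite ler_distl lerBlDr; apply/andP; split; [exact: h2|exact: h1].
Unshelve. all: by end_near. Qed.

End pole.

Unset Implicit Arguments.

Theorem theorem4p2 (R : realType) (n : nat) (hn : (0 < n)%N)
    (d : measure_display) (T : measurableType d) (P : probability T R)
    (X : {RV P >-> n.-tuple R})
    (hcentered : centered X)
    (hid : infinitely_divisible X)
    (hmom : finite_second_moment X)
    (hpos : posdefmx (covmx X))
    (hK : forall t : 'cV[R]_n, (cumulant X t < +oo)%E) :
  (forall u : 'cV[R]_n, unit_sphere u -> radial_pole X u \is a fin_num) /\
  {within unit_sphere, continuous (radial_pole X : 'cV[R]_n -> \bar R)}.
Proof.
have hV (u : 'cV[R]_n) : unit_sphere u -> 0 < var2 X u.
  move=> u1; rewrite -qvarE //; apply: hpos.2.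
  (* Positive definiteness concerns nonzero vectors, and the zero vector has norm [0], not [1]. *)
  apply/eqP => u0; move: u1; rewrite u0 /unit_sphere /= /enorm /dotp.
  rewrite big1 => [|i _]; last by rewrite mxE mul0r.
  by rewrite sqrtr0 => /esym/eqP; rewrite oner_eq0.
split; last exact: radial_pole_continuous.
by move=> u u1; rewrite radial_pole_sphereE.
Qed.
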